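(* Let $b\in\mathbb{R}$, let $1<\alpha<2$, and let ${f:{}_{b}\mathbb{N}\to\mathbb{R}}$ be a function such that ${}_{b}\Delta^{\alpha}f(u)\ge 0$ for all $u\in{}_{b-(2-\alpha)}\mathbb{N}$ and $$f(b-3)\ge \frac{\alpha}{k}f(b-2)+\frac{(k-\alpha)\alpha}{k(k+1)}f(b-1)+\frac{(k+1-\alpha)(k-\alpha)\alpha}{(k+1)(k+2)k}f(b)\quad\text{for each } k\in\{2,3,4,\dots\}.$$ Then $-\nabla f(t)\ge 0$ for all $t\in{}_{b-3}\mathbb{N}$.
   Context: For a real number $c$, ${}_{c}\mathbb{N}=\{c,c-1,c-2,\dots\}$. $\nabla f(t)=f(t)-f(t-1)$, $\nabla^m=\nabla(\nabla^{m-1})$, $\sigma(t)=t+1$. The falling function is $x^{(\beta)}=\Gamma(x+1)/\Gamma(x+1-\beta)$, with the convention that division at a pole yields zero. The delta right fractional sum of order $\beta>0$ ending at $b$ is ${}_{b}\Delta^{-\beta}f(t)=\frac{1}{\Gamma(\beta)}\sum_{s=t+\beta}^{b}(s-\sigma(t))^{(\beta-1)}f(s)$, $t\in{}_{b-\beta}\mathbb{N}$. For noninteger $\alpha>0$ and $n=[\alpha]+1$ (here $n=2$) the delta right (Riemann) fractional difference is ${}_{b}\Delta^{\alpha}f(t)=(-1)^n\nabla^n\,{}_{b}\Delta^{-(n-\alpha)}f(t)$, $t\in{}_{b-(n-\alpha)}\mathbb{N}$. *)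

(* Defs.v *)
From HB Require Import structures.
From mathcomp Require Import all_boot all_order all_algebra.
From mathcomp Require Import all_classical all_reals all_analysis.

Set Implicit Arguments.
Unset Strict Implicit.
Unset Printing Implicit Defensive.

Import Order.TTheory GRing.Theory Num.Theory.
Import numFieldNormedType.Exports.

Local Open Scope classical_set_scope.
Local Open Scope ring_scope.

(** A function on [downN c] is represented by a total function [R -> R]; the
    operators below, evaluated at the points of their domains, only read its
    values on [downN c]. *)

Definition downN {R : realType} (c : R) : set R :=
  [set t | exists k : nat, t = c - k%:R].

Definition nabla {R : realType} (f : R -> R) (t : R) : R := f t - f (t - 1).

Definition sigma {R : realType} (t : R) : R := t + 1.

(** Euler's integral for [0 < x], continued to [x <= 0] by the functional
    equation Gamma x = Gamma (x + n) / (x (x + 1) .. (x + n - 1)), where n is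
    the least natural number such that [0 < x + n].  At a pole one factor of
    the product vanishes, so [Gamma x = 0]; since [y / 0 = 0], division by the
    value at a pole yields zero. *)
Definition Gamma_integral {R : realType} (x : R) : R :=
  \int[@lebesgue_measure R]_(t in `]0%R, +oo[) (t `^ (x - 1) * expR (- t)).

Definition Gamma {R : realType} (x : R) : R :=
  if 0 < x then Gamma_integral x
  else let n := (Num.truncn (- x)).+1 in
       Gamma_integral (x + n%:R) / \prod_(i < n) (x + i%:R).

Definition falling {R : realType} (x beta : R) : R :=
  Gamma (x + 1) / Gamma (x + 1 - beta).

(** The sum over s = a, a + 1, .., b for [b - a] a natural number; the empty sum
    when [b < a]. *)
Definition step_sum {R : realType} (a b : R) (F : R -> R) : R :=
  \sum_(j < Num.truncn (b - a + 1)) F (a + j%:R).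

Definition right_frac_sum {R : realType} (b beta : R) (f : R -> R) (t : R) : R :=
  (Gamma beta)^-1 *
    step_sum (t + beta) b (fun s => falling (s - sigma t) (beta - 1) * f s).

(** Meant for noninteger [0 < alpha]. *)
Definition right_frac_diff {R : realType} (b alpha : R) (f : R -> R) (t : R) : R :=
  let n := (Num.truncn alpha).+1 in
  (-1) ^+ n * iter n nabla (right_frac_sum b (n%:R - alpha) f) t.

(* Main.v *)
(** Write [a i = f (b - i)].  The fractional sum of order [nu = 2 - alpha] is the
    convolution of [a] with the coefficients of (1 - x)^(-nu), so the fractional
    difference is the convolution of the first difference of [a] with the
    coefficients [v] of (1 - x)^(alpha - 1), where [v 0 = 1] and all later
    coefficients are negative.  Solved for the leading term, [0 <= conv v d n]
    with [d n = a n - a (n - 1)] reads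
    d n >= |v 1| d (n - 1) + .. + |v n| d 0,
    and the assumption on [f (b - 3)] for [k = n - 2] says exactly that the last
    four terms have a nonnegative sum; strong induction on [n >= 4] concludes. *)

Require Import Defs.
From mathcomp Require Import all_boot all_order all_algebra.
From mathcomp Require Import all_classical all_reals all_analysis.
From mathcomp Require Import measurable_realfun.
From mathcomp Require Import ring lra.
Import Order.TTheory GRing.Theory Num.Theory.
Import numFieldNormedType.Exports.
Set Implicit Arguments.
Unset Strict Implicit.
Unset Printing Implicit Defensive.
Local Open Scope classical_set_scope.
Local Open Scope ring_scope.

(** * Euler's Gamma at positive arguments: functional equation, and nonvanishing on (0, 1] *)

Section EulerGamma.
Context {R : realType}.
Notation mu := (@lebesgue_measure R).
Implicit Types x t : R.

Definition gamma_integrand x t : R := t `^ (x - 1) * expR (- t).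

(* Extended-real valued, so that the functional equation needs no finiteness: it
   is then used to derive finiteness for [0 < x <= 1] from [egamma 1 = 1]. *)
Definition egamma x : \bar R :=
  (\int[mu]_(t in `]0%R, +oo[) (gamma_integrand x t)%:E)%E.

Lemma Gamma_gt0E x : 0 < x -> Gamma x = fine (egamma x).
Proof. by rewrite /Gamma => ->. Qed.

Lemma gamma_integrand_ge0 x t : 0 <= gamma_integrand x t.
Proof. by rewrite mulr_ge0 ?powR_ge0 ?expR_ge0. Qed.

Lemma measurable_gamma_integrand x (D : set R) :
  measurable_fun D (EFin \o gamma_integrand x).
Proof.
apply/measurable_EFinP/measurable_funM.
  exact: measurable_funTS (measurable_powR _).
by apply: measurable_funTS; apply: measurableT_comp.
Qed.

Lemma is_derive_expRN t : is_derive t 1 (fun t => expR (- t)) (- expR (- t)).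
Proof. by apply: is_derive_eq; rewrite mulrN1. Qed.

(** Makes the boundary term at infinity vanish in the integration by parts. One half of the
    exponential absorbs the power, as exp(t/2) = exp(t/(2x))^x >= (t/(2x))^x; the other half gives
    the decay, as exp(t/2) >= t/2. *)
Lemma powR_expRN_le x t : 0 < x -> 0 < t ->
  t `^ x * expR (- t) <= (2 * x) `^ x * 2 * t^-1.
Proof.
move=> x0 t0; have x2 : 0 < 2 * x by rewrite mulr_gt0.
have -> : expR (- t) = expR (- (t / 2)) * expR (- (t / 2)).
  by rewrite -expRD; congr expR; field.
rewrite mulrA -[leRHS]mulrA; apply: ler_pM.
- by rewrite mulr_ge0 ?powR_ge0 ?expR_ge0.
- exact: expR_ge0.
- rewrite expRN ler_pdivrMr ?expR_gt0//.
  have tx : 0 <= t / (2 * x) by rewrite divr_ge0// ltW.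
  have -> : t `^ x = (2 * x) `^ x * (t / (2 * x)) `^ x.
    by rewrite -powRM ?(ltW x2)// mulrC divfK ?gt_eqF.
  rewrite ler_wpM2l ?powR_ge0//.
  have -> : t / 2 = t / (2 * x) * x by field; rewrite gt_eqF.
  rewrite expRM; apply: ge0_ler_powR; rewrite ?nnegrE ?expR_ge0// ?ltW//.
  by apply: lt_le_trans (expR_ge1Dx _); rewrite ltrDr.
- rewrite expRN -[leRHS]invrK lef_pV2 ?posrE ?expR_gt0 ?invr_gt0 ?divr_gt0//.
  apply: le_trans (expR_ge1Dx _); rewrite invfM invrK; lra.
Qed.

(** Compact intervals away from the possible singularity at 0, on which integration by parts is
    available. Starting at 2 keeps each of them nondegenerate. *)
Lemma itv0y_bigcup : `]0%R, +oo[%classic =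
  \bigcup_n `[(n.+2%:R^-1 : R)%R, n.+2%:R%R]%classic.
Proof.
apply/seteqP; split => [t/=|t [n _]/=]; rewrite !in_itv/= ?andbT; last first.
  by move=> /andP[+ _]; apply: lt_le_trans; rewrite invr_gt0.
move=> t0; pose n := maxn (Num.truncn t) (Num.truncn t^-1).
exists n => //=; rewrite in_itv/=.
have h (y : R) : 0 < y -> (Num.truncn y <= n)%N -> y <= n.+2%:R.
  move=> y0 yn; apply: le_trans (ltW (truncnS_gt _)) _.
  by rewrite ler_nat; apply: leq_trans (leqnSn _).
rewrite h ?leq_maxl// andbT -[leRHS]invrK lef_pV2 ?posrE ?invr_gt0//.
by rewrite h ?invr_gt0// leq_maxr.
Qed.

Lemma continuous_powR x t : 0 < t -> {for t, continuous (@powR R ^~ x)}.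
Proof.
move=> t0; apply/differentiable_continuous/derivable1_diffP.
by apply: derivable_powR; rewrite in_itv/= t0.
Qed.

Lemma continuous_expRN : continuous (fun t => expR (- t) : R).
Proof.
move=> t; apply/differentiable_continuous/derivable1_diffP.
by have [] := is_derive_expRN t.
Qed.

Lemma egamma_parts x a c : 0 < x -> 0 < a -> a < c ->
  (\int[mu]_(t in `[a, c]) (gamma_integrand (x + 1) t)%:E =
   (a `^ x * expR (- a) - c `^ x * expR (- c))%:E
   + x%:E * \int[mu]_(t in `[a, c]) (gamma_integrand x t)%:E)%E.
Proof.
move=> x0 a0 ac.
have pos (t : R) : t \in `[a, c] -> 0 < t.
  by rewrite in_itv/= => /andP[+ _]; exact: lt_le_trans.
have poso (t : R) : t \in `]a, c[ -> 0 < t.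
  by rewrite in_itv/= => /andP[/ltW+ _]; exact: lt_le_trans.
have c0 : 0 < c by exact: lt_trans ac.
under eq_integral do rewrite /gamma_integrand addrK.
rewrite (@integration_by_parts R (@powR R ^~ x) (fun t => - expR (- t))
  (fun t => x * t `^ (x - 1)) (fun t => expR (- t)))//; last first.
- move=> t tac; rewrite derive1E.
  have dE := is_derive_expRN t.
  by rewrite derive_val opprK.
- split.
  + move=> t _; apply: derivableN; by have [] := is_derive_expRN t.
  + by apply: cvgN; apply: cvg_at_right_filter; exact: continuous_expRN.
  + by apply: cvgN; apply: cvg_at_left_filter; exact: continuous_expRN.
- by apply: continuous_subspaceT; exact: continuous_expRN.
- by move=> t /poso t0; rewrite powR_derive1// in_itv/= t0.
- split.
  + by move=> t /poso t0; apply: derivable_powR; rewrite in_itv/= t0.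
  + by apply: cvg_at_right_filter; exact: continuous_powR.
  + by apply: cvg_at_left_filter; exact: continuous_powR.
- apply: continuous_in_subspaceT => t; rewrite inE/= => /pos t0.
  by apply: cvgMl_tmp; exact: continuous_powR.
congr (_ + _)%E; first by congr EFin; ring.
under eq_integral do rewrite mulrN -mulrA EFinN.
rewrite integral_ge0N/=; last first.
  by move=> t _; rewrite lee_fin mulr_ge0 ?gamma_integrand_ge0// ltW.
rewrite oppeK; under eq_integral do rewrite EFinM.
rewrite ge0_integralZl_EFin ?(ltW x0)//.
  by move=> t _; rewrite lee_fin; exact: gamma_integrand_ge0.
exact: measurable_gamma_integrand.
Qed.

Lemma egamma_cvg x :
  (\int[mu]_(t in `[(n.+2%:R^-1 : R)%R, n.+2%:R%R]) (gamma_integrand x t)%:E)%E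
     @[n --> \oo] --> egamma x.
Proof.
rewrite /egamma itv0y_bigcup; apply: ge0_nondecreasing_set_cvg_integral => //.
- apply/nondecreasing_seqP => n; rewrite subsetEset => t/=; rewrite !in_itv/=.
  move=> /andP[t1 t2]; apply/andP; split.
    by apply: le_trans t1; rewrite lef_pV2 ?posrE ?ler_nat.
  by apply: le_trans t2 _; rewrite ler_nat.
- by move=> n; exact: measurable_gamma_integrand.
- by move=> n t _; rewrite lee_fin gamma_integrand_ge0.
Qed.

Lemma cvg_invn2 : (n.+2%:R : R)^-1 @[n --> \oo] --> (0 : R).
Proof. by have := @cvg_harmonic R; rewrite -cvg_shiftS. Qed.

Lemma egammaD1 x : 0 < x -> egamma (x + 1) = (x%:E * egamma x)%E.
Proof.
move=> x0; rewrite -(cvg_lim _ (@egamma_cvg (x + 1)))//; apply: cvg_lim => //.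
under eq_fun.
  move=> n; rewrite egamma_parts//; last first.
    by rewrite (@lt_trans _ _ 1)// ?invf_lt1// ltr1n.
  over.
rewrite -[(x%:E * egamma x)%E]add0e.
apply: cvgeD; first by rewrite fin_num_adde_defr.
  apply: cvg_EFin; first exact: nearW.
  rewrite -[0]subr0; apply: cvgB.
    apply: (@squeeze_cvgr _ _ _ _ (fun=> 0) (fun n => (n.+2%:R : R)^-1 `^ x)).
    - near=> n; rewrite mulr_ge0 ?powR_ge0 ?expR_ge0//=.
      by rewrite ler_piMr ?powR_ge0// -expR0 ler_expR oppr_le0 invr_ge0.
    - exact: cvg_cst.
    - have /cvg_at_rightP := powR_cvg0 x0; apply; split; last exact: cvg_invn2.
      by move=> n; rewrite invr_gt0.
  apply: (@squeeze_cvgr _ _ _ _ (fun=> 0)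
    (fun n => (2 * x) `^ x * 2 * (n.+2%:R : R)^-1)).
  - near=> n; rewrite mulr_ge0 ?powR_ge0 ?expR_ge0//=.
    by rewrite powR_expRN_le.
  - exact: cvg_cst.
  - rewrite -[X in _ --> X](mulr0 ((2 * x) `^ x * 2)).
    by apply: cvgMl_tmp; exact: cvg_invn2.
apply: cvgeZl => //; exact: egamma_cvg.
Unshelve. all: by end_near. Qed.

Lemma egamma1 : egamma 1 = 1%:E.
Proof.
rewrite /egamma.
under eq_integral do rewrite /gamma_integrand subrr powRr0 mul1r.
rewrite integral_itv_obnd_cbnd; last first.
  by apply/measurable_EFinP; apply: measurable_funTS; apply: measurableT_comp.
rewrite (@ge0_continuous_FTC2y _ _ (fun t => - expR (- t)) _ 0).
- by rewrite oppr0 expR0 EFinN oppeK add0e.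
- by move=> t _; exact: expR_ge0.
- by apply: continuous_subspaceT; exact: continuous_expRN.
- by rewrite -oppr0; apply: cvgN; exact: cvgr_expR.
- by move=> t _; apply: derivableN; have [] := is_derive_expRN t.
- by apply: cvgN; apply: cvg_at_right_filter; exact: continuous_expRN.
- move=> t _; rewrite derive1E; have dE := is_derive_expRN t.
  by rewrite derive_val opprK.
Qed.

Lemma egamma_ge0 x : (0 <= egamma x)%E.
Proof. by apply: integral_ge0 => t _; rewrite lee_fin gamma_integrand_ge0. Qed.

Lemma le_egammaD x y z :
  (forall t, 0 < t -> t `^ (x - 1) <= t `^ (y - 1) + t `^ (z - 1)) ->
  (egamma x <= egamma y + egamma z)%E.
Proof.
move=> xyz; rewrite /egamma -ge0_integralD//; last 4 first.
- by move=> t _; rewrite lee_fin gamma_integrand_ge0.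
- exact: measurable_gamma_integrand.
- by move=> t _; rewrite lee_fin gamma_integrand_ge0.
- exact: measurable_gamma_integrand.
apply: ge0_le_integral => //.
- by move=> t _; rewrite lee_fin gamma_integrand_ge0.
- exact: measurable_gamma_integrand.
- by apply: emeasurable_funD; exact: measurable_gamma_integrand.
move=> t/=; rewrite in_itv/= andbT => t0.
by rewrite -EFinD lee_fin -mulrDl ler_wpM2r ?expR_ge0// xyz.
Qed.

(** Since t^x <= 1 + t for 0 < x <= 1, the product x * [egamma x] = [egamma (x + 1)] is at most
    [egamma 1 + egamma 2] = 2. *)
Lemma egamma_lty x : 0 < x <= 1 -> (egamma x < +oo)%E.
Proof.
move=> /andP[x0 x1].
have h : (x%:E * egamma x <= egamma 1 + egamma (1 + 1))%E.
  rewrite -egammaD1//; apply: le_egammaD => t t0.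
  rewrite subrr !addrK powRr0 powRr1 ?(ltW t0)//.
  have [t1|t1] := leP t 1.
    by rewrite -[leLHS]addr0 lerD ?(ltW t0)// -(powRr0 t) ger_powR ?t0 ?t1 ?ltW.
  by rewrite -[leLHS]add0r lerD// ler1_powR// ltW.
move: h; rewrite egammaD1// egamma1 mule1.
have := egamma_ge0 x; case: (egamma x) => [r| |]//= _; first by rewrite ltry.
by rewrite gt0_muley ?lte_fin.
Qed.

(** From 1 <= t^(x-1) + t^x one gets 1 = [egamma 1] <= (1 + x) * [egamma x]. *)
Lemma egamma_gt0 x : 0 < x <= 1 -> (0 < egamma x)%E.
Proof.
move=> /andP[x0 x1]; rewrite lt_neqAle egamma_ge0 andbT; apply/eqP => e0.
have : (egamma 1 <= egamma x + egamma (x + 1))%E.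
  apply: le_egammaD => t t0; rewrite subrr addrK powRr0.
  have [t1|t1] := leP t 1.
    rewrite -[leLHS]addr0 lerD ?powR_ge0// -[leLHS](powRr0 t).
    by rewrite ger_powR ?t0 ?t1// subr_le0.
  by rewrite -[leLHS]add0r lerD ?powR_ge0// -[leLHS](powRr0 t) ler_powR// ltW.
by rewrite egammaD1// -e0 mule0 adde0 egamma1 lee_fin ler10.
Qed.

Lemma GammaD1 x : 0 < x -> Gamma (x + 1) = x * Gamma x.
Proof.
move=> x0; rewrite !Gamma_gt0E ?addr_gt0// egammaD1//.
have := egamma_ge0 x; case: (egamma x) => [r| |]//= _.
(* In the infinite case both sides are 0, because [fine] sends +oo to 0. *)
by rewrite gt0_muley ?lte_fin//= mulr0.
Qed.

Lemma Gamma_neq0 x : 0 < x <= 1 -> Gamma x != 0.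
Proof.
move=> x01; have /andP[x0 _] := x01; rewrite Gamma_gt0E// gt_eqF// fine_gt0//.
by rewrite egamma_gt0// egamma_lty.
Qed.

Lemma Gamma1 : Gamma 1 = 1 :> R.
Proof. by rewrite Gamma_gt0E// egamma1. Qed.

End EulerGamma.

(** * Differences of convolutions *)

Section Convolution.
Context {R : comNzRingType}.
Implicit Types c a : nat -> R.

Definition conv c a (m : nat) : R := \sum_(j < m.+1) c j * a (m - j)%N.

(* With the convention [a (-1) = 0]. *)
Definition bdiff a (n : nat) : R := if n is m.+1 then a n - a m else a n.

Lemma convC c a m : conv c a m = conv a c m.
Proof.
rewrite /conv (reindex_inj rev_ord_inj)/=; apply: eq_bigr => j _.
by rewrite subSS mulrC subKn// leq_ord.
Qed.

Lemma conv_diffr c a m : conv c a m.+1 - conv c a m = conv c (bdiff a) m.+1.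
Proof.
rewrite /conv big_ord_recr/= [in RHS]big_ord_recr/= subnn addrAC -sumrB.
congr (_ + _); apply: eq_bigr => j _.
by rewrite subSn ?leq_ord// mulrBr.
Qed.

(** A difference of a convolution may be moved onto either factor; here each factor receives one of
    the two. *)
Lemma conv_diff2 c a m :
  conv c a m - conv c a m.+1 - (conv c a m.+1 - conv c a m.+2) =
  conv (bdiff c) (bdiff a) m.+2.
Proof.
rewrite (convC (bdiff c)) -conv_diffr !(convC (bdiff a)) -!conv_diffr.
by ring.
Qed.

Lemma convS4 c d m :
  conv c d m.+4 = c 0%N * d m.+4 + \sum_(i < m) c i.+1 * d (m - i.+1).+4 +
    (c m.+1 * d 3 + c m.+2 * d 2 + c m.+3 * d 1%N + c m.+4 * d 0%N).
Proof.
rewrite /conv big_ord_recl/= subn0 4!big_ord_recr/= /bump/= !add1n !subSS subnn.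
rewrite (subSn (leqnn m)) subnn (addnK m 2 : m.+2 - m = 2)%N.
rewrite (addnK m 3 : m.+3 - m = 3)%N -!addrA; congr (_ + (_ + _)).
by apply: eq_bigr => i _; rewrite add1n -[m.+4]addn4 -addnBAC// addn4.
Qed.

End Convolution.

(** * Fractional sums and differences as convolutions *)

Section FractionalDifference.
Context {R : realType}.
Implicit Types (b alpha nu : R) (f : R -> R).

(* The coefficient of x^j in (1 - x)^(-nu). *)
Definition binom_coef nu (j : nat) : R :=
  \prod_(i < j) ((nu + i%:R) / (i%:R + 1)).

Lemma binom_coef0 nu : binom_coef nu 0 = 1.
Proof. exact: big_ord0. Qed.

Lemma binom_coefS nu j :
  binom_coef nu j.+1 = binom_coef nu j * ((nu + j%:R) / (j%:R + 1)).
Proof. exact: big_ord_recr. Qed.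

Lemma natr1_neq0 (j : nat) : (j%:R + 1 : R) != 0.
Proof. by rewrite natr1 pnatr_eq0. Qed.

Lemma Gamma_natD1_neq0 (j : nat) : Gamma (j%:R + 1 : R) != 0.
Proof.
elim: j => [|j IH]; first by rewrite add0r Gamma1 oner_neq0.
by rewrite -natr1 GammaD1 ?natr1 ?ltr0Sn// mulf_neq0// ?pnatr_eq0// -natr1.
Qed.

(** By [GammaD1], both sides are multiplied by (nu + j) / (j + 1) when j increases by 1. *)
Lemma binom_coef_Gamma nu j : 0 < nu <= 1 ->
  Gamma (nu + j%:R) / Gamma (j%:R + 1) = Gamma nu * binom_coef nu j.
Proof.
move=> nu01; have /andP[nu0 _] := nu01.
elim: j => [|j IH]; first by rewrite addr0 add0r Gamma1 binom_coef0 divr1 mulr1.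
rewrite binom_coefS mulrA -IH -natr1 addrA GammaD1 ?ltr_wpDr//.
rewrite [Gamma (j%:R + 1 + 1)]GammaD1 ?natr1 ?ltr0Sn// -natr1.
by field; rewrite Gamma_natD1_neq0 natr1_neq0.
Qed.

Lemma right_frac_sumE b nu f (m : nat) : 0 < nu <= 1 ->
  right_frac_sum b nu f (b - nu - m%:R) =
  conv (binom_coef nu) (fun i => f (b - i%:R)) m.
Proof.
move=> nu01; rewrite /right_frac_sum /step_sum /sigma /falling.
(* The summation points are s = b - (m - j) for j = 0, .., m, hence m + 1 terms. *)
have -> : b - (b - nu - m%:R + nu) + 1 = m.+1%:R :> R by rewrite -natr1; ring.
rewrite natrK mulr_sumr; apply: eq_bigr => j _.
have -> : b - nu - m%:R + nu + j%:R - (b - nu - m%:R + 1) + 1 = nu + j%:R.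
  by ring.
have -> : nu + j%:R - (nu - 1) = j%:R + 1 by ring.
rewrite binom_coef_Gamma// -mulrA mulKf ?Gamma_neq0//; congr (_ * f _).
by rewrite natrB ?leq_ord//; ring.
Qed.

Lemma right_frac_diffE b alpha f (m : nat) : 1 < alpha < 2 ->
  right_frac_diff b alpha f (b - (2 - alpha) - m%:R) =
  conv (bdiff (binom_coef (2 - alpha))) (bdiff (fun i => f (b - i%:R))) m.+2.
Proof.
move=> /andP[alpha1 alpha2]; rewrite /right_frac_diff.
(* So n = 2: the sign is +1, and the order 2 - alpha of the inner sum lies in (0, 1). *)
have -> : Num.truncn alpha = 1%N.
  by apply: truncn_def; rewrite ?ltW//= alpha2 (ltW alpha1).
rewrite sqrrN expr1n mul1r /= /nabla.
have natB1 k : b - (2 - alpha) - k%:R - 1 = b - (2 - alpha) - k.+1%:R.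
  by rewrite -natr1; ring.
by rewrite !natB1 !right_frac_sumE ?conv_diff2//; apply/andP; split; lra.
Qed.

End FractionalDifference.

(** * Signs of the coefficients and the induction *)

Section SignOfCoefficients.
Context {R : realType}.
Variable alpha : R.

(* The coefficients of (1 - x)^(alpha - 1). *)
Definition diff_coef : nat -> R := bdiff (binom_coef (2 - alpha)).

Lemma diff_coefSS k :
  diff_coef k.+2 = diff_coef k.+1 * ((k%:R + 2 - alpha) / (k%:R + 2)).
Proof.
rewrite /diff_coef /= !binom_coefS -!natr1.
have k0 : 0 <= k%:R :> R by [].
by field; rewrite !gt_eqF//; lra.
Qed.

(** The first of these is 1 - alpha < 0, and the ratios (k + 2 - alpha) / (k + 2) are positive. *)
Lemma diff_coefS_lt0 k : 1 < alpha < 2 -> diff_coef k.+1 < 0.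
Proof.
move=> /andP[alpha1 alpha2]; elim: k => [|k IH].
  by rewrite /diff_coef /= binom_coefS binom_coef0 addr0 add0r divr1 mul1r; lra.
rewrite diff_coefSS nmulr_rlt0// divr_gt0//; have : 0 <= k%:R :> R by []; lra.
Qed.

(** Collecting the coefficient of each [a i] and expressing every [v] through [v k.+1] produces the
    rational weights of the hypothesis, taken at [k.+2]. *)
Lemma diff_coef_head (a : nat -> R) k (v := diff_coef) (d := bdiff a) :
  v k.+1 * d 3 + v k.+2 * d 2 + v k.+3 * d 1%N + v k.+4 * d 0%N =
  v k.+1 * (a 3 - (alpha / k.+2%:R * a 2
       + (k.+2%:R - alpha) * alpha / (k.+2%:R * (k.+2%:R + 1)) * a 1%N
       + (k.+2%:R + 1 - alpha) * (k.+2%:R - alpha) * alpha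
           / ((k.+2%:R + 1) * (k.+2%:R + 2) * k.+2%:R) * a 0%N)).
Proof.
rewrite /v /d !diff_coefSS /= -!natr1.
have k0 : 0 <= k%:R :> R by [].
by field; rewrite !gt_eqF//; lra.
Qed.

Lemma bdiff_ge0 (a : nat -> R) : 1 < alpha < 2 ->
  (forall m, 0 <= conv diff_coef (bdiff a) m.+2) ->
  (forall k : nat, (2 <= k)%N ->
       alpha / k%:R * a 2
       + (k%:R - alpha) * alpha / (k%:R * (k%:R + 1)) * a 1%N
       + (k%:R + 1 - alpha) * (k%:R - alpha) * alpha
           / ((k%:R + 1) * (k%:R + 2) * k%:R) * a 0%N <= a 3) ->
  forall m, 0 <= bdiff a m.+4.
Proof.
move=> alpha12 ha hk m; have [n] := ubnP m; elim: n m => // n IH m mn.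
have := ha m.+2; rewrite convS4 [diff_coef 0]binom_coef0 mul1r.
have head : diff_coef m.+1 * bdiff a 3 + diff_coef m.+2 * bdiff a 2
  + diff_coef m.+3 * bdiff a 1%N + diff_coef m.+4 * bdiff a 0%N <= 0.
  rewrite diff_coef_head; apply: mulr_le0_ge0; first exact/ltW/diff_coefS_lt0.
  by rewrite subr_ge0 hk.
(* Each difference here has smaller index, so the induction hypothesis applies; for m = 0 the sum is
   empty. *)
have : \sum_(i < m) diff_coef i.+1 * bdiff a (m - i.+1).+4 <= 0.
  apply: sumr_le0 => i _; apply: mulr_le0_ge0; first exact/ltW/diff_coefS_lt0.
  apply: IH; apply: leq_trans (mn : m <= n)%N.
  by rewrite ltn_subrL (leq_trans _ (ltn_ord i)).
lra.
Qed.

End SignOfCoefficients.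

Theorem theorem4p5 (R : realType) (b alpha : R) (f : R -> R)
    (halpha1 : 1 < alpha) (halpha2 : alpha < 2)
    (hdiff : forall u : R, downN (b - (2 - alpha)) u ->
       0 <= right_frac_diff b alpha f u)
    (hf : forall k : nat, (2 <= k)%N ->
       alpha / k%:R * f (b - 2)
       + (k%:R - alpha) * alpha / (k%:R * (k%:R + 1)) * f (b - 1)
       + (k%:R + 1 - alpha) * (k%:R - alpha) * alpha
           / ((k%:R + 1) * (k%:R + 2) * k%:R) * f b
       <= f (b - 3)) :
  forall t : R, downN (b - 3) t -> 0 <= - nabla f t.
Proof.
have alpha12 : 1 < alpha < 2 by rewrite halpha1.
pose a i := f (b - i%:R).
have da_ge0 m : 0 <= bdiff a m.+4.
  apply: (bdiff_ge0 alpha12) => [{}m|k k2]; last by rewrite /a subr0; exact: hf.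
  by rewrite -right_frac_diffE//; apply: hdiff; exists m.
move=> _ [k ->]; have := da_ge0 k; rewrite /bdiff /a /nabla opprB.
(* At t = b - 3 - k, [- nabla f t] is [a k.+4 - a k.+3]. *)
have natE : b - 3 - k%:R = b - k.+3%:R by rewrite -!natr1; ring.
have natSE : b - k.+3%:R - 1 = b - k.+4%:R by rewrite -[in RHS]natr1; ring.
by rewrite natE natSE.
Qed.
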